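(* Let $(X,d)$ be an ultrametric space, let $(Y,\rho)$ be a metric space, let $\eta\colon[0,\infty)\to[0,\infty)$ be a homeomorphism with $\eta(1)=1$, and let $f\colon X\to Y$ be an $\eta$-quasisymmetric embedding. Then $(f(X),\rho)$ is also an ultrametric space.
   Context: An ultrametric space is a metric space $(X,d)$ satisfying $d(x,y)\leqslant\max\{d(x,z),d(z,y)\}$ for all $x,y,z\in X$. An embedding between metric spaces is an injective continuous mapping that is a homeomorphism onto its image. Given a homeomorphism $\eta\colon[0,\infty)\to[0,\infty)$, an embedding $f\colon X\to Y$ between metric spaces $(X,d)$ and $(Y,\rho)$ is $\eta$-quasisymmetric if for all $a,b,x\in X$ and all $t>0$, $d(x,a)\leqslant t\,d(x,b)$ implies $\rho(f(x),f(a))\leqslant\eta(t)\,\rho(f(x),f(b))$. The set $f(X)$ carries the restriction of $\rho$. *)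

(* Defs.v *)
From HB Require Import structures.
From mathcomp Require Import all_boot all_order all_algebra.
From mathcomp Require Import all_classical all_reals all_analysis.
Set Implicit Arguments.
Unset Strict Implicit.
Unset Printing Implicit Defensive.
Import Order.TTheory GRing.Theory Num.Theory.
Import numFieldNormedType.Exports.
Local Open Scope classical_set_scope.
Local Open Scope ring_scope.

(* The library equips [set_type A] with the pseudometric structure whose balls
   are the traces of the balls of [M]; the distance below is compatible with
   it, so that the subset topology is the metric topology. *)
Section subset_metric.
Context {R : realType} {M : metricType R} (A : set M).

Let d (x y : A) : R := mdist (set_val x) (set_val y).

Let d_ge0 (x y : A) : 0 <= d x y. Proof. exact: mdist_ge0. Qed.

Let d_positivity (x y : A) : d x y = 0 -> x = y.
Proof. by move=> /mdist_positivity/val_inj. Qed.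

Let ballEd (x : A) (r : R) : ball x r = [set y | d x y < r].
Proof. by rewrite -initial_ballE ballEmdist. Qed.

HB.instance Definition _ :=
  @PseudoMetric_isMetric.Build R (set_type A) d d_ge0 d_positivity ballEd.

End subset_metric.

Definition ultrametric (R : realType) (M : metricType R) : Prop :=
  forall x y z : M, mdist x y <= Num.max (mdist x z) (mdist z y).

Definition homeomorphism (X Y : topologicalType) (f : X -> Y) : Prop :=
  exists g : Y -> X,
    [/\ cancel f g, cancel g f, continuous f & continuous g].

Definition to_range (X Y : Type) (f : X -> Y) (x : X) : range f :=
  exist _ (f x) (mem_set (imageT f x)).

Definition embedding (X Y : topologicalType) (f : X -> Y) : Prop :=
  [/\ injective f, continuous f & homeomorphism (to_range f)].

(* [0, +oo) as a type, with the topology induced by R. *)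
Notation halfline R := (set_type (`[(0 : R), +oo[%classic)).

Lemma halfline1_subproof (R : realType) : (1 : R) \in `[(0 : R), +oo[%classic.
Proof. by rewrite inE/= in_itv/= ler01. Qed.

Definition halfline1 (R : realType) : halfline R :=
  exist _ 1 (halfline1_subproof R).

Definition quasisymmetric (R : realType) (X Y : metricType R)
    (eta : halfline R -> halfline R) (f : X -> Y) : Prop :=
  forall (a b x : X) (t : halfline R), 0 < set_val t ->
    mdist x a <= set_val t * mdist x b ->
    mdist (f x) (f a) <= set_val (eta t) * mdist (f x) (f b).

(* Main.v *)
Require Import Defs.
From HB Require Import structures.
From mathcomp Require Import all_boot all_order all_algebra.
From mathcomp Require Import all_classical all_reals all_analysis.
Import Order.TTheory GRing.Theory Num.Theory.
Import numFieldNormedType.Exports.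
Local Open Scope classical_set_scope.
Local Open Scope ring_scope.

(** Quasisymmetry at $t = 1$ with $\eta(1) = 1$ says that $f$ preserves non-strict comparisons of
    two distances measured from a common point ([quasisymmetric_le]). The ultrametric inequality is
    such a comparison: being below a maximum means $d(x,y) \leqslant d(x,z)$, two distances from
    $x$, or $d(x,y) \leqslant d(z,y)$, two distances from $y$. Either one passes to the images. *)

Lemma quasisymmetric_le (R : realType) (X Y : metricType R)
    (eta : halfline R -> halfline R) (f : X -> Y) (x a b : X) :
  eta (halfline1 R) = halfline1 R -> quasisymmetric eta f ->
  mdist x a <= mdist x b -> mdist (f x) (f a) <= mdist (f x) (f b).
Proof.
move=> eta1 f_qs xab; have := f_qs a b x (halfline1 R).
by rewrite eta1 /= !mul1r; apply; rewrite ?ltr01.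
Qed.

Theorem proposition3p2 (R : realType) (X Y : metricType R)
    (eta : halfline R -> halfline R) (f : X -> Y)
    (X_ultra : ultrametric X)
    (eta_homeo : homeomorphism eta)
    (eta1 : eta (halfline1 R) = halfline1 R)
    (f_emb : embedding f)
    (f_qs : quasisymmetric eta f) :
  ultrametric (range f).
Proof.
move=> u v w.
(* The distance on [range f] is by definition that of [Y] between underlying points. *)
change (mdist (set_val u) (set_val v) <=
  Num.max (mdist (set_val u) (set_val w)) (mdist (set_val w) (set_val v))).
have [x _ <-] : range f (set_val u) := set_valP u.
have [y _ <-] : range f (set_val v) := set_valP v.
have [z _ <-] : range f (set_val w) := set_valP w.
have := X_ultra x y z; rewrite !le_max => /orP[xyz|xyz]; apply/orP.
  by left; exact: quasisymmetric_le eta1 f_qs xyz.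
(* Here the common point is [y]; symmetry moves it to the first argument, as [quasisymmetric_le]
   requires. *)
right; rewrite metric_sym (metric_sym (f z)).
by apply: quasisymmetric_le eta1 f_qs _; rewrite metric_sym (metric_sym y).
Qed.
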